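(* For all integers $n>m\ge 0$ there exist complex polynomials $p_n$ of degree $n$ and $q_m$ of degree $m$ such that the harmonic polynomial $h(z)=p_n(z)+\overline{q_m(z)}$ has at least $m^2+m+n$ distinct zeros in $\mathbb{C}$.
   Context: Degrees are exact: $p_n$ and $q_m$ are polynomials in the complex variable $z$ with complex coefficients, $\deg p_n=n$ and $\deg q_m=m$. A zero (root) of $h$ is a point $z\in\mathbb{C}$ with $h(z)=0$. *)

(* Defs.v *)
From mathcomp Require Import all_boot all_order all_algebra.
From mathcomp Require Import reals.
From mathcomp.real_closed Require Import complex.

Set Implicit Arguments.
Unset Strict Implicit.
Unset Printing Implicit Defensive.

Import Order.TTheory GRing.Theory Num.Theory.

Local Open Scope ring_scope.
Local Open Scope complex_scope.

(* A realType is a complete Archimedean ordered field, i.e. the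
   real line up to isomorphism, so R[i] is the field of complex numbers. *)
Definition harmonic_poly (R : realType) (p q : {poly R[i]}) (z : R[i]) : R[i] :=
  p.[z] + conjc q.[z].

Definition has_at_least_zeros (R : realType) (h : R[i] -> R[i]) (N : nat) : Prop :=
  exists s : seq R[i],
    [/\ uniq s, (N <= size s)%N & forall z : R[i], z \in s -> h z = 0].

(* Main.v *)
(* Put N = m + 1 and choose distinct unit complex numbers a, b different from 1.
   With w = conj z, the two equations z^N = a w^N and (z - 1)^N = b (w - 1)^N
   each cut out N real lines (through 0 and through 1), and these meet in N^2
   points.  In b (z^N - a w^N) - a ((z - 1)^N - b (w - 1)^N) the terms w^N cancel,
   so it is a harmonic polynomial of type (N, m) vanishing at these N^2 points,
   all of which are zeros with nonvanishing Jacobian.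
   For n = N + k with k > 0, add t^k z^n with t > 0 small.  By a contraction
   argument the N^2 zeros persist, and after rescaling z = w / t the same argument
   yields k further zeros of size about 1/t near the roots of w^k = a - b.
   The total is N^2 + k = m^2 + m + n. *)
Require Import Defs.
From mathcomp Require Import all_boot all_order all_algebra.
From mathcomp Require Import separable.
From mathcomp Require Import boolp classical_sets reals.
From mathcomp.real_closed Require Import complex.
From mathcomp Require Import ring lra zify.

Set Implicit Arguments.
Unset Strict Implicit.
Unset Printing Implicit Defensive.

Import Order.TTheory GRing.Theory Num.Theory ComplexField.Normc.

Local Open Scope ring_scope.
Local Open Scope complex_scope.
Local Notation Re := complex.Re.
Local Notation Im := complex.Im.

(** * The modulus of a complex number, with values in the real field *)

Section Norm.
Variable R : rcfType.
Implicit Types x y z : R[i].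

Lemma normc_ge0 x : 0 <= normc x.
Proof. by case: x => a b; rewrite sqrtr_ge0. Qed.

Lemma normc_eq0 x : (normc x == 0) = (x == 0).
Proof.
by apply/eqP/eqP => [|->]; [exact: eq0_normc | rewrite normc0].
Qed.

Lemma normc_gt0 x : (0 < normc x) = (x != 0).
Proof. by rewrite lt0r normc_eq0 normc_ge0 andbT. Qed.

Lemma normc_opp x : normc (- x) = normc x.
Proof. exact: normcN. Qed.

Lemma normc_conj x : normc (conjc x) = normc x.
Proof. by case: x => a b /=; rewrite sqrrN. Qed.

Lemma normc_add x y : normc (x + y) <= normc x + normc y.
Proof. exact: le_normcD. Qed.

Lemma normc_sub x y : normc (x - y) <= normc x + normc y.
Proof. by rewrite -(normc_opp y) normc_add. Qed.

Lemma normcB x y : normc (x - y) = normc (y - x).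
Proof. by rewrite -normc_opp opprB. Qed.

Lemma normc_real (a : R) : normc a%:C = `|a|.
Proof. by rewrite /normc /= expr0n /= addr0 sqrtr_sqr. Qed.

Lemma normr_Re x : `|Re x| <= normc x.
Proof.
by case: x => a b /=; rewrite -sqrtr_sqr ler_wsqrtr // lerDl sqr_ge0.
Qed.

Lemma normr_Im x : `|Im x| <= normc x.
Proof.
by case: x => a b /=; rewrite -sqrtr_sqr ler_wsqrtr // lerDr sqr_ge0.
Qed.

Lemma normc_le_ReIm x : normc x <= `|Re x| + `|Im x|.
Proof.
case: x => a b /=; rewrite -(ler_pXn2r (n := 2)) ?nnegrE ?sqrtr_ge0 ?addr_ge0 //.
rewrite sqr_sqrtr ?addr_ge0 ?sqr_ge0 // sqrrD !real_normK ?num_real //.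
by rewrite -addrA lerD2l lerDr mulrn_wge0 // mulr_ge0.
Qed.

End Norm.

(** * Completeness and the contraction principle on a closed disc *)

Section Contraction.
Variable R : realType.

(** If [a] were positive, some natural [k] would exceed [c / a], and [k < 2 ^ k] would contradict
    the bound at [k]. *)
Lemma le0_geometric (a c : R) : (forall k, a <= c / 2 ^+ k) -> a <= 0.
Proof.
move=> ale; rewrite leNgt; apply/negP => a0.
have [k ltk] : exists k : nat, c / a < k%:R.
  exists (Num.bound `|c / a|); apply: le_lt_trans (ler_norm _) _.
  exact: archi_boundP (normr_ge0 _).
have := ale k; rewrite ler_pdivlMr ?exprn_gt0 // => leac.
have : (k%:R : R) < 2 ^+ k by rewrite -natrX ltr_nat ltn_expl.
move: ltk; rewrite ltr_pdivrMr // => ltk lt2.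
have : k%:R * a < 2 ^+ k * a by rewrite ltr_pM2r.
by rewrite [2 ^+ k * a]mulrC; move=> *; lra.
Qed.

(** With [t k = c / 2 ^ k] the intervals from [u k - t k] to [u k + t k] are nested, because [t k]
    is twice [t k.+1]. The supremum of the left endpoints lies in all of them. *)
Lemma geometric_cvg (u : nat -> R) (c : R) : 0 <= c ->
  (forall k, `|u k.+1 - u k| <= c / 2 ^+ k.+1) ->
  exists x, forall k, `|u k - x| <= c / 2 ^+ k.
Proof.
move=> c0 cu; pose t k := c / 2 ^+ k.
have t0 k : 0 <= t k by rewrite divr_ge0 ?exprn_ge0.
have tS k : t k = t k.+1 + t k.+1.
  by rewrite /t exprS; field; rewrite expf_neq0 ?pnatr_eq0.
have step k : - t k.+1 <= u k.+1 - u k <= t k.+1 by rewrite -ler_norml; exact: cu.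
have lo k l : u k - t k <= u (k + l)%N - t (k + l)%N.
  elim: l => [|l IHl]; first by rewrite addn0.
  by rewrite addnS; have /andP[] := step (k + l)%N; have := tS (k + l)%N; move=> *; lra.
have hi k l : u (k + l)%N + t (k + l)%N <= u k + t k.
  elim: l => [|l IHl]; first by rewrite addn0.
  by rewrite addnS; have /andP[] := step (k + l)%N; have := tS (k + l)%N; move=> *; lra.
have lohi k l : u k - t k <= u l + t l.
  have := lo k l; have := hi l k; have := t0 (k + l)%N.
  by rewrite [(l + k)%N]addnC => *; lra.
pose A := [set y : R | exists k, y = u k - t k]%classic.
have A0 : (A !=set0)%classic by exists (u 0%N - t 0%N), 0%N.
exists (sup A) => k; rewrite -/(t k).
have : u k - t k <= sup A.
  apply: ub_le_sup; last by exists k.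
  by exists (u 0%N + t 0%N) => y [l ->].
have : sup A <= u k + t k by apply: ge_sup => // y [l ->].
by move=> h1 h2; rewrite ler_norml; apply/andP; split; lra.
Qed.

Lemma contraction_fixpoint (T : R[i] -> R[i]) (z0 : R[i]) (r : R) :
  (forall z z', normc (z - z0) <= r -> normc (z' - z0) <= r ->
     normc (T z - T z') <= normc (z - z') / 2) ->
  normc (T z0 - z0) <= r / 2 ->
  exists2 z, normc (z - z0) <= r & T z = z.
Proof.
move=> ctr T0; pose u k := iter k T z0; pose t k := r / 2 ^+ k.
have r0 : 0 <= r by have := normc_ge0 (T z0 - z0); move=> *; lra.
have t0 k : 0 <= t k by rewrite divr_ge0 ?exprn_ge0.
have tS k : t k.+1 = t k / 2 by rewrite /t exprS; field; rewrite expf_neq0 ?pnatr_eq0.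
(* The margin [t k] left in the second bound is the sum of all later step bounds [t j] with [j > k],
   so the orbit never leaves the disc. *)
have [step ball] : (forall k, normc (u k.+1 - u k) <= t k.+1) /\
    (forall k, normc (u k - z0) <= r - t k).
  suff H k : normc (u k.+1 - u k) <= t k.+1 /\ normc (u k - z0) <= r - t k.
    by split=> k; case: (H k).
  elim: k => [|k [IH1 IH2]].
    rewrite /u /= subrr normc0 /t expr1 expr0 divr1 subrr lexx; split => //.
  have IH3 : normc (u k.+1 - z0) <= r - t k.+1.
    have := normc_add (u k.+1 - u k) (u k - z0); rewrite addrA subrK.
    by have := tS k; move=> *; lra.
  split=> //; rewrite tS.
  have := ctr (u k.+1) (u k) _ _; rewrite -/(u k.+2) => ctr'.
  have := t0 k.+1; have := t0 k => ? ?.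
  apply: (le_trans (ctr' _ _)); move=> *; lra.
have [x xP] : exists x, forall k, `|Re (u k) - x| <= t k.
  apply: geometric_cvg => // k; apply: le_trans (step k).
  by rewrite -raddfB normr_Re.
have [y yP] : exists y, forall k, `|Im (u k) - y| <= t k.
  apply: geometric_cvg => // k; apply: le_trans (step k).
  by rewrite -raddfB normr_Im.
pose z := x +i* y.
have cvg k : normc (u k - z) <= 2 * t k.
  have := normc_le_ReIm (u k - z); have := xP k; have := yP k.
  by case: (u k) => a b /=; move=> *; lra.
have zball : normc (z - z0) <= r.
  rewrite -subr_le0; apply: (@le0_geometric _ (2 * r)) => k.
  have := normc_sub (u k - z0) (u k - z); rewrite opprB addrC addrA subrK.
  have := ball k; have := cvg k; have := t0 k; rewrite -mulrA -/(t k); move=> *; lra.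
exists z => //; apply/eqP; rewrite -subr_eq0 -normc_eq0 eq_le normc_ge0 andbT.
apply: (@le0_geometric _ (2 * r)) => k; rewrite -mulrA -/(t k).
have := normc_sub (u k.+1 - z) (u k.+1 - T z).
have -> : u k.+1 - z - (u k.+1 - T z) = T z - z by ring.
have := ctr (u k) z _ zball; rewrite -/(u k.+1) => ctr'.
have := cvg k; have := cvg k.+1; have := tS k; have := ball k; have := t0 k.
move=> h1 h2 h3 h4 h5 h6; have := ctr' _; move=> *; lra.
Qed.

End Contraction.

(** * Persistence of nondegenerate zeros under small perturbations *)

Section Stability.
Variable R : realType.
Implicit Types (p q : {poly R[i]}) (z : R[i]).

(** Differentiability is wanted in its strict form, uniform in two moving points: only this makes
    the Newton map a contraction on a whole disc. *)
Lemma horner_strict_diff p z0 (e : R) : 0 < e ->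
  exists2 r : R, 0 < r & forall z z', normc (z - z0) <= r -> normc (z' - z0) <= r ->
    normc (p.[z] - p.[z'] - p^`().[z0] * (z - z')) <= e * normc (z - z').
Proof.
elim/poly_ind: p e => [|p c IHp] e e0.
  exists 1 => // z z' _ _; rewrite deriv0 !horner0 subrr mul0r subrr normc0.
  by rewrite mulr_ge0 ?normc_ge0 ?ltW.
pose A := normc z0 + 1; pose D := normc p^`().[z0] + 1.
have A0 : 0 < A by rewrite ltr_wpDl ?normc_ge0.
have D0 : 0 < D by rewrite ltr_wpDl ?normc_ge0.
(* The bound 1 yields the crude Lipschitz constant [D] in [rP1]; the bound [e / (2 * A)] controls
   the remainder once it is multiplied by [z']. *)
have e10 : 0 < Num.min 1 (e / (2 * A)) by rewrite lt_min ltr01 divr_gt0 ?mulr_gt0.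
have [r r0 rP] := IHp _ e10.
have rP1 z : normc (z - z0) <= r -> normc (p.[z] - p.[z0]) <= D * normc (z - z0).
  move=> zr; have := rP z z0 zr; rewrite subrr normc0 => /(_ (ltW r0)).
  have := normc_add (p.[z] - p.[z0] - p^`().[z0] * (z - z0)) (p^`().[z0] * (z - z0)).
  rewrite subrK normcM => h1 h2.
  have h3 : Num.min 1 (e / (2 * A)) * normc (z - z0) <= normc (z - z0).
    by rewrite -[leRHS]mul1r ler_wpM2r ?normc_ge0 // ge_min lexx.
  by rewrite /D [leRHS]mulrDl mul1r; lra.
have h2 z z' : normc (z - z0) <= r -> normc (z' - z0) <= r ->
    normc (p.[z] - p.[z'] - p^`().[z0] * (z - z')) <= e / (2 * A) * normc (z - z').
  move=> zr zr'; apply: le_trans (rP z z' zr zr') _.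
  by rewrite ler_wpM2r ?normc_ge0 // ge_min lexx orbT.
(* The error [e] is spent as e/2 on [z'] times the remainder of [p], e/4 on [p.[z] - p.[z0]] and e/4
   on [d * (z' - z0)]. The cap 1 ensures that [z'] has modulus at most [A]. *)
pose r' := Num.min r (Num.min 1 (e / (4 * D))).
have r'0 : 0 < r' by rewrite !lt_min r0 ltr01 divr_gt0 ?mulr_gt0.
have [r'r r'1 r'e] : [/\ r' <= r, r' <= 1 & r' <= e / (4 * D)].
  by rewrite !ge_min !lexx !orbT.
exists r' => // z z' zr zr'.
rewrite derivMXaddC !hornerMXaddC hornerD hornerM hornerX.
set d := p^`().[z0].
have -> : p.[z] * z + c - (p.[z'] * z' + c) - (p.[z0] + d * z0) * (z - z') =
  z' * (p.[z] - p.[z'] - d * (z - z')) + ((p.[z] - p.[z0]) + d * (z' - z0)) * (z - z').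
  by ring.
have zA : normc z' <= A.
  have := normc_add (z' - z0) z0; rewrite subrK /A; move=> *; lra.
apply: le_trans (normc_add _ _) _; rewrite !normcM.
have -> : e * normc (z - z') = A * (e / (2 * A) * normc (z - z')) +
    (D * (e / (4 * D)) + D * (e / (4 * D))) * normc (z - z').
  by field; rewrite !gt_eqF.
apply: lerD.
  apply: ler_pM; rewrite ?normc_ge0 //; apply: h2; exact: le_trans r'r.
apply: ler_wpM2r; first exact: normc_ge0.
apply: le_trans (normc_add _ _) _; rewrite normcM; apply: lerD.
  apply: le_trans (rP1 _ (le_trans zr r'r)) _.
  by rewrite ler_pM2l //; exact: le_trans r'e.
apply: ler_pM; rewrite ?normc_ge0 ?(le_trans zr') //.
by rewrite /D lerDl.
Qed.

Lemma harmonic_strict_diff p q z0 (e : R) : 0 < e ->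
  exists2 r : R, 0 < r & forall z z', normc (z - z0) <= r -> normc (z' - z0) <= r ->
    normc (harmonic_poly p q z - harmonic_poly p q z' -
      (p^`().[z0] * (z - z') + conjc (q^`().[z0] * (z - z')))) <= e * normc (z - z').
Proof.
move=> e0; have e20 : 0 < e / 2 by rewrite divr_gt0.
have [r r0 rP] := horner_strict_diff p z0 e20.
have [s s0 sP] := horner_strict_diff q z0 e20.
exists (Num.min r s); first by rewrite lt_min r0 s0.
move=> z z'; rewrite !le_min => /andP[zr zs] /andP[zr' zs'].
have := rP _ _ zr zr'; have := sP _ _ zs zs'; rewrite /harmonic_poly.
set u := p.[z] - _ - _; set v := q.[z] - _ - _ => hv hu.
have -> : p.[z] + (q.[z])^* - (p.[z'] + (q.[z'])^*) -
   (p^`().[z0] * (z - z') + (q^`().[z0] * (z - z'))^*) = u + conjc v.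
  by rewrite /u /v !rmorphB; ring.
by apply: le_trans (normc_add _ _) _; rewrite normc_conj; lra.
Qed.

(** The inequality says that the Jacobian |p'|^2 - |q'|^2 of the harmonic polynomial does not
    vanish; its sign is left free. *)
Definition regular_zero p q z :=
  harmonic_poly p q z = 0 /\
  p^`().[z] * conjc p^`().[z] != q^`().[z] * conjc q^`().[z].

(** As a real-linear map of the plane, [v |-> a * v + b * conjc v] has determinant |a|^2 - |b|^2, a
    real number, and Cramer's rule gives the inverse explicitly. *)
Lemma real_linear_inverse (a b : R[i]) : a * conjc a != b * conjc b ->
  exists (K : R[i] -> R[i]) (M : R),
    [/\ 0 < M, {morph K : u v / u - v},
        forall v, K (a * v + b * conjc v) = v,
        forall u, a * K u + b * conjc (K u) = u
      & forall u, normc (K u) <= M * normc u].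
Proof.
rewrite -subr_eq0; set D := _ - _ => D0.
have DJ : conjc D = D by rewrite /D rmorphB !rmorphM /= !conjcK ![_^* * _]mulrC.
exists (fun u => (conjc a * u - b * conjc u) / D).
exists ((normc a + normc b) / normc D + 1); split.
- by rewrite ltr_wpDl // divr_ge0 ?addr_ge0 ?normc_ge0.
- by move=> u v; rewrite rmorphB; ring.
- move=> v; rewrite rmorphD !rmorphM /= conjcK; apply: (mulIf D0).
  by rewrite mulfVK // /D; ring.
- move=> u; rewrite rmorphM fmorphV /= DJ rmorphB !rmorphM /= !conjcK.
  apply: (mulIf D0); rewrite mulrDl !mulrA !mulfVK // /D; ring.
move=> u; rewrite normcM normcV.
have : (normc a * normc u + normc b * normc u) / normc D <=
    ((normc a + normc b) / normc D + 1) * normc u.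
  by rewrite -mulrDl mulrAC [leRHS]mulrDl lerDl mul1r normc_ge0.
apply: le_trans; rewrite ler_wpM2r ?invr_ge0 ?normc_ge0 //.
by apply: le_trans (normc_sub _ _) _; rewrite !normcM !normc_conj.
Qed.

(* Simplified Newton iteration: the map z |-> z - K (f z), with K the inverse
   of the differential at z0, is a contraction near z0. *)
Lemma regular_zero_stable p q z0 (rho : R) : 0 < rho -> regular_zero p q z0 ->
  exists2 e : R, 0 < e & forall g : R[i] -> R[i],
    normc (g z0) <= e ->
    (forall z z', normc (z - z0) <= 1 -> normc (z' - z0) <= 1 ->
       normc (g z - g z') <= e * normc (z - z')) ->
    exists2 z, normc (z - z0) <= rho & harmonic_poly p q z + g z = 0.
Proof.
move=> rho0 [hz0 reg].
(* The differential at [z0] is [v |-> p' * v + conjc q' * conjc v], so the second coefficient is the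
   conjugate of q'. *)
have reg' : p^`().[z0] * conjc p^`().[z0] != conjc q^`().[z0] * conjc (conjc q^`().[z0]).
  by rewrite conjcK [X in _ != X]mulrC.
have [K [M [M0 KB KL LK normK]]] := real_linear_inverse reg'.
have e40 : 0 < (4 * M)^-1 by rewrite invr_gt0 mulr_gt0.
have [r r0 rP] := harmonic_strict_diff p q z0 e40.
pose s := Num.min r (Num.min 1 rho).
have s0 : 0 < s by rewrite !lt_min r0 ltr01.
have [sr s1 srho] : [/\ s <= r, s <= 1 & s <= rho] by rewrite !ge_min !lexx !orbT.
(* [(4 * M)^-1] shares the contraction factor 1/2 equally between the remainder of the harmonic
   polynomial and the variation of [g]; [s / (2 * M)] keeps the first Newton step within [s / 2]. *)
pose e := Num.min (4 * M)^-1 (s / (2 * M)).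
have [e1 e2] : e <= (4 * M)^-1 /\ e <= s / (2 * M) by rewrite !ge_min !lexx !orbT.
exists e; first by rewrite lt_min e40 divr_gt0 ?mulr_gt0.
move=> g g0 glip.
pose f z := harmonic_poly p q z + g z.
pose T z := z - K (f z).
have [||z zs Tz] := @contraction_fixpoint R T z0 s.
- move=> z z' zs zs'.
  set w := harmonic_poly p q z - harmonic_poly p q z' -
      (p^`().[z0] * (z - z') + conjc (q^`().[z0] * (z - z'))).
  have -> : T z - T z' = K (g z' - g z) - K w.
    rewrite -KB (_ : _ - w =
      p^`().[z0] * (z - z') + conjc q^`().[z0] * conjc (z - z') - (f z - f z')).
      by rewrite !KB KL /T; ring.
    by rewrite /w /f rmorphM /=; ring.
  apply: le_trans (normc_sub _ _) _; rewrite addrC.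
  have -> : normc (z - z') / 2 =
      M * ((4 * M)^-1 * normc (z - z')) + M * ((4 * M)^-1 * normc (z - z')).
    by field; rewrite gt_eqF.
  apply: lerD; apply: le_trans (normK _) _; rewrite ler_pM2l //.
    by apply: rP; apply: le_trans sr.
  rewrite normcB; apply: le_trans (glip _ _ _ _) _; [exact: le_trans s1|exact: le_trans s1|].
  by rewrite ler_wpM2r ?normc_ge0.
- have -> : T z0 - z0 = - K (g z0) by rewrite /T /f hz0 add0r addrC addKr.
  rewrite normc_opp; apply: le_trans (normK _) _.
  have -> : s / 2 = M * (s / (2 * M)) by field; rewrite gt_eqF.
  by rewrite ler_pM2l // (le_trans g0).
exists z; first exact: le_trans srho.
rewrite -/(f z) -[f z]LK.
have -> : K (f z) = 0.
  by move/eqP: Tz; rewrite /T -subr_eq0 addrAC subrr add0r oppr_eq0 => /eqP.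
by rewrite rmorph0 !mulr0 addr0.
Qed.

Lemma horner_lipschitz p (z0 : R[i]) : exists2 C : R, 0 <= C &
  forall z z', normc (z - z0) <= 1 -> normc (z' - z0) <= 1 ->
    normc (p.[z] - p.[z']) <= C * normc (z - z').
Proof.
elim/poly_ind: p => [|p c [C C0 IHp]].
  by exists 0 => // z z' _ _; rewrite !horner0 subrr normc0 mul0r.
pose B := normc p.[z0] + C; pose A := normc z0 + 1.
exists (B + A * C); first by rewrite !addr_ge0 ?mulr_ge0 ?addr_ge0 ?normc_ge0.
move=> z z' zr zr'; rewrite !hornerMXaddC.
have -> : p.[z] * z + c - (p.[z'] * z' + c) = p.[z] * (z - z') + z' * (p.[z] - p.[z']).
  by ring.
apply: le_trans (normc_add _ _) _; rewrite !normcM mulrDl -mulrA; apply: lerD.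
  rewrite ler_wpM2r ?normc_ge0 //.
  have := IHp z z0 zr; rewrite subrr normc0 => /(_ ler01) h.
  have := normc_add (p.[z] - p.[z0]) p.[z0]; rewrite subrK => h2.
  have : C * normc (z - z0) <= C * 1 by rewrite ler_wpM2l.
  by rewrite /B; lra.
apply: ler_pM; rewrite ?normc_ge0 ?IHp //.
by have := normc_add (z' - z0) z0; rewrite subrK /A; move=> *; lra.
Qed.

End Stability.

(** * The equation x^k = a and the model harmonic polynomial with k^2 zeros *)

(** The polynomial X^k - a is separable: k times it minus X times its derivative is the nonzero
    constant -k a, so its linear factors are distinct. *)
Lemma roots_of_pow (F : numClosedFieldType) (a : F) k : (0 < k)%N -> a != 0 ->
  exists s : seq F, [/\ uniq s, size s = k & forall x, x \in s -> x ^+ k = a].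
Proof.
case: k => // k _ a0; have [s sE] := closed_field_poly_normal (F := F) ('X^(k.+1) - a%:P).
have lc : lead_coef ('X^(k.+1) - a%:P) = 1 by apply/monicP; exact: monicXnsubC.
rewrite lc scale1r in sE.
exists s; split.
- rewrite -separable_prod_XsubC -sE separable_poly.unlock; apply/coprimepP => d.
  rewrite derivB derivC subr0 derivXn => d1 d2.
  have : d %| ('X^(k.+1) - a%:P) *+ k.+1 - 'X * ('X^k *+ k.+1).
    by rewrite dvdp_sub ?dvdp_mull // -mulr_natr dvdp_mulr.
  rewrite mulrnAr -exprS -mulrnBl addrAC subrr add0r.
  rewrite -polyCN -polyCMn -alg_polyC dvdpZr ?mulrn_eq0 ?oppr_eq0 //.
  by rewrite dvdp1 size_poly_eq1.
- by have := size_prod_XsubC s id; rewrite -sE size_XnsubC //; case.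
move=> x; rewrite -root_prod_XsubC -sE rootE !hornerE subr_eq0.
by move/eqP.
Qed.

Section Model.
Variable R : realType.
Local Notation C := R[i].

Lemma conjcB (x y : C) : conjc (x - y) = conjc x - conjc y.
Proof. exact: rmorphB. Qed.

Lemma conjcN (x : C) : conjc (- x) = - conjc x.
Proof. exact: rmorphN. Qed.

Lemma conjcM (x y : C) : conjc (x * y) = conjc x * conjc y.
Proof. exact: rmorphM. Qed.

Lemma conjcX (x : C) k : conjc (x ^+ k) = conjc x ^+ k.
Proof. exact: rmorphXn. Qed.

Lemma conjc_unit (x : C) : x * conjc x = 1 -> x != 0 /\ conjc x = x^-1.
Proof.
move=> x1; have x0 : x != 0.
  by apply: contra_eq_neq x1 => ->; rewrite mul0r eq_sym oner_eq0.
by split=> //; apply: (mulfI x0); rewrite x1 divff.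
Qed.

Lemma unit_root_pow (x a : C) k : (0 < k)%N ->
  a * conjc a = 1 -> x ^+ k = a -> x * conjc x = 1.
Proof.
move=> k0 a1 xk; apply/eqP; rewrite -(@pexpr_eq1 _ _ k) ?mulcJ_ge0 //.
by rewrite exprMn -rmorphXn /= xk a1.
Qed.

(** Since X - (X - 1) = 1, the difference of powers is a sum of k + 1 monic polynomials of degree k,
    so its leading coefficient is k + 1. *)
Lemma size_expXn_sub k : size ('X^(k.+1) - ('X - 1%:P) ^+ k.+1 : {poly C}) = k.+1.
Proof.
rewrite subrXX opprB addrCA subrr addr0 mul1r.
have sz i : (i < k.+1)%N ->
    ('X^(k.+1.-1 - i) * ('X - 1%:P) ^+ i : {poly C}) \is monic /\
    size ('X^(k.+1.-1 - i) * ('X - 1%:P) ^+ i : {poly C}) = k.+1.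
  move=> ik; split; first by rewrite monicMl ?monicXn ?monic_exp ?monicXsubC.
  rewrite size_monicM ?monicXn ?monic_neq0 ?monic_exp ?monicXsubC //.
  by rewrite size_polyXn size_exp_XsubC addnS /= addSn subnK.
apply/eqP; rewrite eqn_leq; apply/andP; split.
  apply: leq_trans (size_sum _ _ _) _; apply/bigmax_leqP => i _.
  by case: (sz i (ltn_ord i)) => _ ->.
rewrite ltnNge; apply/negP => /leq_sizeP/(_ k (leqnn k)).
rewrite coef_sum (eq_bigr (fun=> 1)) => [|i _].
  by rewrite sumr_const card_ord => /eqP; rewrite pnatr_eq0.
by case: (sz i (ltn_ord i)) => /monicP; rewrite lead_coefE => + szE; rewrite szE.
Qed.

Lemma harmonic_model_roots (a b : C) k : (0 < k)%N ->
  a * conjc a = 1 -> b * conjc b = 1 -> a != 1 -> b != 1 -> a != b ->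
  exists s : seq C, [/\ uniq s, size s = (k * k)%N & forall z, z \in s ->
    regular_zero (b *: 'X^k - a *: ('X - 1%:P) ^+ k)
      (- (conjc a * conjc b) *: ('X^k - ('X - 1%:P) ^+ k)) z].
Proof.
move=> k0 a1 b1 aN1 bN1 ab.
have [a0 aV] := conjc_unit a1; have [b0 bV] := conjc_unit b1.
have [s [us ss sP]] := roots_of_pow k0 a0.
have [t [ut st tP]] := roots_of_pow k0 b0.
(* For x^k = a and y^k = b, the line z = x w through 0 meets the line z - 1 = y (w - 1) through 1,
   where w is the conjugate of z. Solving this linear system gives z = [Z x y] and w = [W x y]. *)
pose Z (x y : C) := x * (1 - y) / (x - y).
pose W (x y : C) := (1 - y) / (x - y).
have props x y : x \in s -> y \in t ->
    [/\ x != 0 /\ y != 0, conjc x = x^-1 /\ conjc y = y^-1, x != 1 /\ y != 1,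
      x - y != 0 & conjc (Z x y) = W x y].
  move=> /sP xk /tP yk.
  have [x0 xV] := conjc_unit (unit_root_pow k0 a1 xk).
  have [y0 yV] := conjc_unit (unit_root_pow k0 b1 yk).
  have xy : x - y != 0.
    by rewrite subr_eq0; apply: contra_neq ab => xy; rewrite -xk -yk xy.
  split=> //.
    split; [apply: contra_neq aN1 | apply: contra_neq bN1] => e.
      by rewrite -xk e expr1n.
    by rewrite -yk e expr1n.
  rewrite /Z /W rmorphM fmorphV !rmorphM !rmorphB rmorph1 /= xV yV.
  by field; rewrite mulN1r -[y - x]opprB oppr_eq0 x0 y0 xy.
have ZxW x y : Z x y = x * W x y by rewrite /Z /W mulrA.
have Z1 x y : x \in s -> y \in t -> Z x y - 1 = y * (W x y - 1).
  by move=> xs yt; case: (props _ _ xs yt) => _ _ _ xy _; rewrite /Z /W; field.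
have W0 x y : x \in s -> y \in t -> W x y != 0.
  move=> xs yt; case: (props _ _ xs yt) => _ _ [_ y1] xy _.
  by rewrite mulf_neq0 ?invr_eq0 // subr_eq0 eq_sym.
have W1 x y : x \in s -> y \in t -> W x y - 1 != 0.
  move=> xs yt; case: (props _ _ xs yt) => _ _ [x1 _] xy _.
  have -> : W x y - 1 = (1 - x) / (x - y) by rewrite /W; field.
  by rewrite mulf_neq0 ?invr_eq0 // subr_eq0 eq_sym.
exists [seq Z x y | x <- s, y <- t]; split.
(* The point determines its two lines: x = Z / W and y = (Z - 1) / (W - 1). The denominators are
   nonzero because y and x differ from 1. *)
- apply: allpairs_uniq => // -[x y] [x' y'].
  rewrite /= => /allpairsP[[u v] /= [xs yt [? ?]]] /allpairsP[[u' v'] /= [xs' yt' [? ?]]].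
  subst u v u' v'; move=> e; have eW : W x y = W x' y'.
    case: (props _ _ xs yt) => _ _ _ _ <-; case: (props _ _ xs' yt') => _ _ _ _ <-.
    by rewrite e.
  congr (_, _).
    by apply: (mulIf (W0 _ _ xs yt)); rewrite -ZxW e ZxW -eW.
  by apply: (mulIf (W1 _ _ xs yt)); rewrite -Z1 // e Z1 // -eW.
- by rewrite size_allpairs ss st.
move=> z /allpairsP[[x y] /= [xs yt ->]].
case: (props _ _ xs yt) => -[x0 y0] [xV yV] [x1 y1] xy ZJ.
have := ZxW x y; have := Z1 _ _ xs yt; have := W0 _ _ xs yt; have := W1 _ _ xs yt.
move: (W x y) ZJ => w; move: (Z x y) => {}z ZJ w1 w0 zw1 zw.
have zJ : conjc (z - 1) = w - 1 by rewrite rmorphB rmorph1 /= ZJ.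
split.
  rewrite /harmonic_poly !hornerE !(conjcM, conjcN, conjcB, conjcX, conjcK).
  rewrite conjc1 ZJ zw1 zw !exprMn (sP _ xs) (tP _ yt).
  by ring.
case: k k0 {ss st} sP tP => // k _ sP tP.
have hE := (hornerD, hornerN, hornerZ, hornerMn, hornerXn, horner_exp, hornerX, hornerC).
have -> : (b *: 'X^(k.+1) - a *: ('X - 1%:P) ^+ k.+1)^`().[z] =
    k.+1%:R * (b * z ^+ k - a * (z - 1) ^+ k).
  rewrite !(derivB, derivZ, derivXn, deriv_exp, derivX, derivC) subr0 mul1r.
  by rewrite !hE /= mulr_natl mulrnBl !mulrnAr.
have -> : (- (conjc a * conjc b) *: ('X^(k.+1) - ('X - 1%:P) ^+ k.+1))^`().[z] =
    k.+1%:R * (- (conjc a * conjc b) * (z ^+ k - (z - 1) ^+ k)).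
  rewrite !(derivB, derivZ, derivXn, deriv_exp, derivX, derivC) subr0 mul1r.
  by rewrite !hE /= mulr_natl -mulrnBl mulrnAr.
rewrite !(conjcM, conjcN, conjcB, conjcX, conjcK, conjc_nat, conjc1) ZJ.
have Kn0 : k.+1%:R != 0 :> C by rewrite pnatr_eq0.
have [Ak0 Bk0] : w ^+ k != 0 /\ (w - 1) ^+ k != 0 by rewrite !expf_neq0.
rewrite -subr_eq0 zw1 zw !exprMn aV bV -(sP _ xs) -(tP _ yt) !exprS.
set K := k.+1%:R; set A := w ^+ k; set B := (w - 1) ^+ k.
have [X0 Y0] : x ^+ k != 0 /\ y ^+ k != 0 by rewrite !expf_neq0.
have : y * y ^+ k - x * x ^+ k != 0.
  by rewrite -!exprS (sP _ xs) (tP _ yt) subr_eq0 eq_sym.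
move: (x ^+ k) (y ^+ k) X0 Y0 => X Y X0 Y0 XY.
(* The Jacobian factors completely. Here [y * Y - x * X] is b - a, and [x - y] is nonzero because a
   and b differ. *)
rewrite [X in X != 0](_ : _ = K * K * A * B * (y * Y - x * X) * (x - y) / (x * y)).
  by rewrite !mulf_neq0 ?invr_eq0 ?mulf_neq0.
by field; rewrite x0 y0 X0 Y0.
Qed.

End Model.

(** * Perturbed families: zeros that stay near and zeros that come from infinity *)

Section Perturbation.
Variable R : realType.
Local Notation C := R[i].

Lemma small_forall (T : eqType) (s : seq T) (P : T -> R -> Prop) :
  (forall x, x \in s -> exists2 e : R, 0 < e & forall t, 0 < t -> t <= e -> P x t) ->
  exists2 e : R, 0 < e & forall t, 0 < t -> t <= e -> forall x, x \in s -> P x t.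
Proof.
elim: s => [|x s IHs] H; first by exists 1.
have [e e0 eP] := H x (mem_head _ _).
have [y ys|d d0 dP] := IHs; first by apply: H; rewrite in_cons ys orbT.
exists (Num.min e d); first by rewrite lt_min e0 d0.
move=> t t0; rewrite le_min => /andP[te td] y.
by rewrite in_cons => /orP[/eqP ->|]; [exact: eP | exact: dP].
Qed.

(** Any [rho] below half the least distance between distinct points of [s] works: points with a
    common image are at most [2 * rho] apart. *)
Lemma separation (s : seq C) : exists2 rho : R, 0 < rho &
  forall f : C -> C, (forall z, z \in s -> normc (f z - z) <= rho) ->
    {in s &, injective f}.
Proof.
have [|e e0 eP] := @small_forall _ [seq (x, y) | x <- s, y <- s]
    (fun xy t => xy.1 != xy.2 -> 2 * t < normc (xy.1 - xy.2)).
  move=> [x y] /= _; case: (eqVneq x y) => [_|xy]; first by exists 1.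
  have n0 : 0 < normc (x - y) by rewrite normc_gt0 subr_eq0.
  by exists (normc (x - y) / 3) => [|t t0 tle _]; lra.
exists e => // f fP x y xs ys fxy; apply/eqP; apply: contraT => xy.
have := eP e e0 (lexx _) (x, y) (allpairs_f _ xs ys) xy => /=.
have := fP x xs; have := fP y ys; rewrite fxy => h1 h2.
have := normc_sub (f y - y) (f y - x).
have -> : f y - y - (f y - x) = x - y by ring.
by move=> *; lra.
Qed.

(** The perturbation is O(t) both in value at the centre and in Lipschitz constant on the unit disc
    around it, the two quantities that [regular_zero_stable] asks to be small. *)
Definition small_family (G : R -> C -> C) := forall z0, exists2 c : R, 0 <= c &
  forall t, 0 < t -> t <= 1 -> normc (G t z0) <= c * t /\
    forall z z', normc (z - z0) <= 1 -> normc (z' - z0) <= 1 ->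
      normc (G t z - G t z') <= c * t * normc (z - z').

Lemma small_family_poly (p : {poly C}) k :
  small_family (fun t z => (t ^+ k.+1)%:C * p.[z]).
Proof.
move=> z0; have [c c0 cP] := horner_lipschitz p z0.
exists (normc p.[z0] + c); first by rewrite addr_ge0 ?normc_ge0.
move=> t t0 t1; have tk : `|t ^+ k.+1| <= t.
  rewrite ger0_norm ?exprn_ge0 ?(ltW t0) // exprS -[leRHS]mulr1.
  by rewrite ler_pM2l // exprn_ile1 // (ltW t0).
split=> [|z z' zr zr'].
  rewrite normcM normc_real [leRHS]mulrC.
  by apply: ler_pM; rewrite ?normc_ge0 // lerDl.
rewrite -mulrBr normcM normc_real mulrAC [leRHS]mulrC.
apply: ler_pM; rewrite ?normc_ge0 //.
apply: le_trans (cP _ _ zr zr') _.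
by rewrite ler_wpM2r ?normc_ge0 // lerDr normc_ge0.
Qed.

Lemma small_familyD (G H : R -> C -> C) : small_family G -> small_family H ->
  small_family (fun t z => G t z + H t z).
Proof.
move=> sG sH z0; have [c c0 cP] := sG z0; have [d d0 dP] := sH z0.
exists (c + d); first exact: addr_ge0.
move=> t t0 t1; have [c1 c2] := cP t t0 t1; have [d1 d2] := dP t t0 t1.
split=> [|z z' zr zr'].
  by apply: le_trans (normc_add _ _) _; rewrite mulrDl lerD.
have -> : G t z + H t z - (G t z' + H t z') = (G t z - G t z') + (H t z - H t z').
  by ring.
by apply: le_trans (normc_add _ _) _; rewrite !mulrDl lerD ?c2 ?d2.
Qed.

Lemma small_family_conj (G : R -> C -> C) : small_family G ->
  small_family (fun t z => conjc (G t z)).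
Proof.
move=> sG z0; have [c c0 cP] := sG z0; exists c => // t t0 t1.
have [c1 c2] := cP t t0 t1; split=> [|z z' zr zr']; first by rewrite normc_conj.
by rewrite -conjcB normc_conj c2.
Qed.

Lemma small_family_sum n (G : nat -> R -> C -> C) :
  (forall i, (i < n)%N -> small_family (G i)) ->
  small_family (fun t z => \sum_(i < n) G i t z).
Proof.
elim: n => [|n IHn] H.
  move=> z0; exists 0 => // t _ _; rewrite big_ord0 normc0 mul0r; split=> // z z' _ _.
  by rewrite !big_ord0 subrr normc0 mul0r.
rewrite (_ : (fun t z => _) = fun t z => \sum_(i < n) G i t z + G n t z).
  by apply: small_familyD; [apply: IHn => i /ltnW; exact: H | exact: H].
by apply/funext => t; apply/funext => z; rewrite big_ord_recr.
Qed.

(** Each zero in the finite list persists for small [t], and a radius within the bound of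
    [separation] keeps the displaced zeros distinct. *)
Lemma regular_zeros_stable (p q : {poly C}) (s : seq C) (G : R -> C -> C) (d : R) :
  0 < d -> uniq s -> (forall z, z \in s -> regular_zero p q z) -> small_family G ->
  exists2 e : R, 0 < e & forall t, 0 < t -> t <= e -> exists s' : seq C,
    [/\ uniq s', size s' = size s & forall z', z' \in s' ->
      harmonic_poly p q z' + G t z' = 0 /\
      exists2 z, z \in s & normc (z' - z) <= d].
Proof.
move=> d0 us reg sG; have [rho rho0 rhoP] := separation s.
pose r := Num.min d rho.
have r0 : 0 < r by rewrite lt_min d0 rho0.
have [rd rrho] : r <= d /\ r <= rho by rewrite !ge_min !lexx !orbT.
have [z zs|e e0 eP] := @small_forall _ s (fun z t =>
    exists2 z', normc (z' - z) <= r & harmonic_poly p q z' + G t z' = 0).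
  have [e e0 eP] := regular_zero_stable r0 (reg z zs).
  have [c c0 cP] := sG z; have c10 : 0 < c + 1 by rewrite ltr_wpDl.
  exists (Num.min 1 (e / (c + 1))); first by rewrite lt_min ltr01 divr_gt0.
  move=> t t0; rewrite le_min => /andP[t1 te].
  have [g1 g2] := cP t t0 t1.
  have cte : c * t <= e.
    move: te; rewrite ler_pdivlMr // => te; apply: le_trans te.
    by rewrite mulrC ler_pM2l // lerDl.
  apply: eP => [|x y xz yz]; first exact: le_trans cte.
  by apply: le_trans (g2 _ _ xz yz) _; rewrite ler_wpM2r ?normc_ge0.
exists e => // t t0 te; have {}eP := eP t t0 te.
(* Choice needs a value at every point; outside [s] it is the dummy 0. *)
have ex z : exists z', z \in s ->
    normc (z' - z) <= r /\ harmonic_poly p q z' + G t z' = 0.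
  case: (boolP (z \in s)) => zs; last by exists 0.
  by have [z' h1 h2] := eP z zs; exists z'.
have [f fP] := boolp.choice ex.
exists (map f s); split; last 1 first.
- move=> _ /mapP[z zs ->]; have [h1 h2] := fP z zs; split => //.
  by exists z => //; exact: le_trans rd.
- rewrite map_inj_in_uniq //; apply: rhoP => z /fP[h1 _].
  exact: le_trans rrho.
- by rewrite size_map.
Qed.

(* Under z = w / t the polynomial p + t^k X^(N+k), with p of degree N, becomes
   t^-N (w^(N+k) + p_N w^N + O(t)), so its zeros of size 1/t are governed by
   the equation w^k = - p_N. *)
Lemma far_zeros (p q : {poly C}) N k :
  (0 < k)%N -> (size p = N.+1)%N -> (size q <= N)%N ->
  exists2 rho : R, 0 < rho & exists2 e : R, 0 < e &
    forall t, 0 < t -> t <= e -> exists s : seq C,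
    [/\ uniq s, size s = k & forall z, z \in s ->
      harmonic_poly (p + (t ^+ k)%:C *: 'X^(N + k)) q z = 0 /\
      rho <= normc z * t].
Proof.
move=> k0 szp szq; pose c := p`_N.
have c0 : c != 0.
  by rewrite /c -[N]/(N.+1.-1) -szp -lead_coefE lead_coef_eq0 -size_poly_gt0 szp.
have cN0 : - c != 0 by rewrite oppr_eq0.
have [s [us ss sP]] := roots_of_pow k0 cN0.
have s0 w : w \in s -> w != 0.
  move=> /sP wk; apply: contraNneq c0 => w0; move: wk; rewrite w0 expr0n gtn_eqF //.
  by move=> /esym/eqP; rewrite oppr_eq0.
(* With [rho] at most half the modulus of every root, a point within [rho] of a root still has
   modulus at least [rho]. *)
have [|rho rho0 rhoP] := @small_forall _ s (fun w t => 2 * t <= normc w).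
  move=> w /s0 w0; exists (normc w / 2) => [|t _ tle]; last by lra.
  by rewrite divr_gt0 ?normc_gt0.
have {}rhoP := rhoP rho rho0 (lexx _).
pose P : {poly C} := 'X^(N + k) + c *: 'X^N.
have reg w : w \in s -> regular_zero P 0 w.
  move=> ws; have wk := sP w ws; split.
    rewrite /harmonic_poly horner0 conjc0 addr0 /P !hornerE exprD wk; ring.
  rewrite deriv0 !horner0 mul0r mulf_eq0 conjc_eq0 orbb.
  rewrite /P derivD derivZ !derivXn hornerD hornerZ !hornerMn !hornerXn.
  (* Multiplying the derivative of [P] by [w] avoids predecessor exponents; with w^k = -c it becomes
     -k c w^N, which is nonzero. *)
  have wX M : w * (w ^+ M.-1 *+ M) = w ^+ M *+ M.
    by case: M => [|M]; rewrite ?mulr0n ?mulr0 // mulrnAr -exprS.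
  rewrite -(mulrI_eq0 _ (mulfI (s0 w ws))) mulrDr mulrCA !wX exprD wk mulrnDr.
  rewrite [X in X != 0](_ : _ = - (c * w ^+ N) *+ k); last by ring.
  by rewrite mulrn_eq0 negb_or -lt0n k0 oppr_eq0 mulf_neq0 ?expf_neq0 ?(s0 w).
(* These are the terms of t^N r(w / t) below degree N. Each carries a power t^(N - i) with i < N,
   written as a successor to fit [small_family_poly]. *)
pose S (r : {poly C}) t w := \sum_(i < N) (t ^+ (N - i).-1.+1)%:C * (r`_i *: 'X^i).[w].
have smallS r : small_family (S r).
  apply: (small_family_sum (G := fun i t w =>
    (t ^+ (N - i).-1.+1)%:C * (r`_i *: 'X^i).[w])) => i _.
  exact: small_family_poly.
have sG := small_familyD (smallS p) (small_family_conj (smallS q)).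
have [e e0 eP] := regular_zeros_stable rho0 us reg sG.
exists rho => //; exists e => // t t0 te.
have [s' [us' ss' s'P]] := eP t t0 te.
have t0' : t%:C != 0 :> C by rewrite (inj_eq (@complexI R)) gt_eqF.
exists [seq w / t%:C | w <- s']; split.
- by rewrite map_inj_uniq //; apply: mulIf; rewrite invr_eq0.
- by rewrite size_map ss'.
move=> _ /mapP[w /s'P[hw [w' /rhoP w's ww']] ->].
have scaled (r : {poly C}) : (size r <= N.+1)%N ->
    t%:C ^+ N * r.[w / t%:C] = S r t w + r`_N * w ^+ N.
  move=> szr; rewrite (horner_coef_wide _ szr) big_ord_recr /= mulrDr; congr (_ + _).
    rewrite mulr_sumr; apply: eq_bigr => i _; rewrite hornerZ hornerXn.
    rewrite prednK ?subn_gt0 // rmorphXn /= -{1}(subnK (ltnW (ltn_ord i))) exprD.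
    by rewrite expr_div_n; field; rewrite expf_neq0.
  by rewrite expr_div_n; field; rewrite expf_neq0.
split; last first.
  rewrite normcM normcV normc_real ger0_norm ?(ltW t0) // mulfVK ?gt_eqF //.
  have := normc_sub w (w - w'); rewrite opprB addrC subrK => *; lra.
have tN0 : t%:C ^+ N != 0 by rewrite expf_neq0.
apply: (mulfI tN0); rewrite mulr0 -hw /harmonic_poly horner0 conjc0 addr0.
rewrite mulrDr hornerD mulrDr (scaled p) ?szp // hornerZ hornerXn.
(* As q has degree below N, its conjugate contributes only O(t) and leaves the limit equation
   unchanged. *)
have -> : t%:C ^+ N * conjc q.[w / t%:C] = conjc (S q t w).
  have := congr1 conjc (scaled q (leqW szq)).
  by rewrite (nth_default _ szq) mul0r addr0 conjcM conjcX conjc_real.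
rewrite /P hornerD hornerZ !hornerXn expr_div_n rmorphXn /= !exprD -/c.
have tk0 : t%:C ^+ k != 0 by rewrite expf_neq0.
move: (t%:C ^+ N) (t%:C ^+ k) tN0 tk0 (S p t w) (conjc (S q t w)) => A B A0 B0 U V.
by field; rewrite A0 B0.
Qed.

End Perturbation.

(* size p = n.+1 says that p is nonzero of exact degree n. *)
Theorem theorem3 (R : realType) (n m : nat) (lt_mn : (m < n)%N) :
  exists p q : {poly R[i]},
    [/\ size p = n.+1,
        size q = m.+1
      & has_at_least_zeros (harmonic_poly p q) (m ^ 2 + m + n)%N].
Proof.
have count k : (m ^ 2 + m + (m.+1 + k) = m.+1 * m.+1 + k)%N by lia.
pose a : R[i] := -1; pose b : R[i] := 'i%C.
have a1 : a * conjc a = 1 by rewrite /a conjcN conjc1 mulrNN mulr1.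
have b1 : b * conjc b = 1.
  by apply/eqP; rewrite eq_complex /=; apply/andP; split; apply/eqP; ring.
have aN1 : a != 1 by rewrite eq_sym -subr_eq0 opprK -mulr2n pnatr_eq0.
have bN1 : b != 1 by rewrite eq_complex /= oner_eq0 andbF.
have ab : a != b by rewrite eq_sym eq_complex /= oppr0 oner_eq0 andbF.
have [s [us ss sP]] := harmonic_model_roots (ltn0Sn m) a1 b1 aN1 bN1 ab.
set p := _ - _ in sP; set q := _ *: _ in sP.
have szq : size q = m.+1.
  rewrite size_scale ?size_expXn_sub // oppr_eq0 mulf_neq0 //.
    by rewrite conjc_eq0 oppr_eq0 oner_eq0.
  by rewrite conjc_eq0 eq_complex /= oner_eq0 andbF.
have szp : size p = m.+2.
  (* This form shows that the coefficient of X^(m+1) is b - a, the other summand having degree at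
     most m. *)
  have -> : p = (b - a) *: 'X^(m.+1) + a *: ('X^(m.+1) - ('X - 1%:P) ^+ m.+1).
    by rewrite /p scalerBl scalerBr addrA subrK.
  have szX : size ((b - a) *: 'X^(m.+1) : {poly R[i]}) = m.+2.
    by rewrite size_scale ?size_polyXn // subr_eq0 eq_sym.
  rewrite size_polyDl szX // ltnS.
  by apply: leq_trans (size_scale_leq _ _) _; rewrite size_expXn_sub.
have [->|nm] := eqVneq n m.+1.
  exists p, q; split=> //; exists s; split=> // [|z /sP[]] //.
  by rewrite ss -[m.+1 in leqLHS]addn0 count addn0.
have lt_m1n : (m.+1 < n)%N by rewrite ltn_neqAle eq_sym nm.
pose k := (n - m.+1)%N.
have kn : n = (m.+1 + k)%N by rewrite subnKC.
have k0 : (0 < k)%N by rewrite subn_gt0.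
have [rho rho0 [e e0 farP]] := far_zeros k0 szp (eq_leq szq).
have [k' kk'] : exists k', k = k'.+1 by exists k.-1; rewrite prednK.
have [d d0 nearP] := regular_zeros_stable ltr01 us sP (small_family_poly ('X^n) k').
rewrite -kk' in nearP.
(* For such [t], zeros within distance 1 of [s] satisfy |z| t < rho, whereas the far zeros satisfy
   |z| t >= rho; hence the two lists are disjoint. *)
have [z zs|c c0 cP] := @small_forall R _ s (fun z t => (normc z + 1) * t < rho).
  have n0 : 0 < normc z + 1 by rewrite ltr_wpDl ?normc_ge0.
  exists (rho / (normc z + 1) / 2); first by rewrite !divr_gt0.
  move=> t t0; rewrite ler_pdivlMr // ler_pdivlMr // => tle; lra.
pose t := Num.min e (Num.min d c).
have t0 : 0 < t by rewrite !lt_min e0 d0.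
have [te td tc] : [/\ t <= e, t <= d & t <= c] by rewrite !ge_min !lexx !orbT.
have [s1 [us1 ss1 s1P]] := nearP t t0 td.
have [s2 [us2 ss2 s2P]] := farP t t0 te.
have szX : size ((t ^+ k)%:C *: 'X^n : {poly R[i]}) = n.+1.
  rewrite size_scale ?size_polyXn //.
  by rewrite (inj_eq (@complexI R)) expf_neq0 // gt_eqF.
exists (p + (t ^+ k)%:C *: 'X^n), q; split=> //.
  by rewrite addrC size_polyDl szX // szp.
exists (s1 ++ s2); split.
- rewrite cat_uniq us1 us2 andbT; apply/hasPn => z /s2P[_ far]; apply/negP.
  move=> /s1P[_ [w ws near]]; have := cP t t0 tc w ws; rewrite ltNge => /negP; apply.
  apply: le_trans far _; rewrite ler_wpM2r ?(ltW t0) //.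
  by have := normc_add (z - w) w; rewrite subrK; move=> *; lra.
- by rewrite size_cat ss1 ss2 ss kn count.
move=> z; rewrite mem_cat => /orP[/s1P[h _]|/s2P[h _]]; last by rewrite kn.
by rewrite -h /harmonic_poly hornerD hornerZ addrAC.
Qed.
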